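(* There is a constant $d>0$ such that for every natural number $n$ there are at least $\lfloor 2^n/d \rfloor$ binary strings $x$ of length $n$ with $C(x\mid n) \geq n$; likewise, there is a constant $d>0$ such that for every $n$ there are at least $\lfloor 2^n/d\rfloor$ binary strings $x$ of length $n$ with $C(x) \geq n$.
   Context: Fix a standard enumeration $T_0,T_1,\ldots$ of Turing machines and a universal Turing machine $U$ with $U(\langle\langle i,p\rangle,y\rangle)=T_i(\langle p,y\rangle)$, where $\langle\cdot,\cdot\rangle$ is a standard one-to-one pairing of strings. The conditional Kolmogorov complexity is $C(x\mid y)=\min\{l(p): U(\langle p,y\rangle)=x\}$, where $l(p)$ is the length of the binary string $p$, and $C(x)=C(x\mid\epsilon)$ with $\epsilon$ the empty string. Natural numbers are identified with binary strings via the length-increasing lexicographic order ($\epsilon\mapsto 0$, $0\mapsto 1$, $1\mapsto 2$, $00\mapsto 3,\ldots$), so $C(x\mid n)$ makes sense. *)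

(* Defs.v *)
From HB Require Import structures.
From mathcomp Require Import all_boot all_order all_algebra.
From mathcomp Require Import boolp.

Set Implicit Arguments.
Unset Strict Implicit.
Unset Printing Implicit Defensive.

Notation string := bitseq.

(* Standard pairing <x, y> = 1^{l(x)} 0 x y (x made self-delimiting, followed  *)
(* by y); its length is l(y) + 2 l(x) + 1.                                     *)
Definition pair_str (x y : string) : string :=
  nseq (size x) true ++ false :: x ++ y.

Lemma pair_str_inj x1 y1 x2 y2 :
  pair_str x1 y1 = pair_str x2 y2 -> x1 = x2 /\ y1 = y2.
Proof.
rewrite /pair_str => e.
have es : size x1 = size x2.
  have sz : forall z w : string,
      find negb (nseq (size z) true ++ false :: w) = size z.
    by move=> z w; elim: (size z) => //= k ->.
  by rewrite -(sz x1 (x1 ++ y1)) e sz.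
move: e; rewrite es => /eqP.
by rewrite eqseq_cat // eqxx /= eqseq_cons eqxx /= eqseq_cat //
  => /andP[/eqP-> /eqP->].
Qed.

(* Successor in the length-increasing lexicographic order, on strings written  *)
(* with their last bit first.                                                  *)
Fixpoint succ_rev (s : string) : string :=
  match s with
  | [::] => [:: false]
  | false :: s' => true :: s'
  | true :: s' => false :: succ_rev s'
  end.

Definition str_of_nat (n : nat) : string := rev (iter n succ_rev [::]).

(* The binary numeral 1s is one more than the number of the string s.          *)
Definition nat_of_str (s : string) : nat :=
  (foldl (fun k (b : bool) => k.*2 + b) 1 s).-1.

Lemma str_of_natK : cancel str_of_nat nat_of_str.
Proof.
pose v s := foldr (fun (b : bool) k => k.*2 + b) 1 s.
have vS s : v (succ_rev s) = (v s).+1.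
  by elim: s => [|[] s IHs] //=; rewrite ?IHs ?doubleS ?addn0 ?addn1.
move=> n; rewrite /nat_of_str /str_of_nat foldl_rev -/(v _).
suff -> : v (iter n succ_rev [::]) = n.+1 by [].
by elim: n => //= n IHn; rewrite vS IHn.
Qed.

Lemma nat_of_strK : cancel nat_of_str str_of_nat.
Proof.
pose v s := foldr (fun (b : bool) k => k.*2 + b) 1 s.
have vS s : v (succ_rev s) = (v s).+1.
  by elim: s => [|[] s IHs] //=; rewrite ?IHs ?doubleS ?addn0 ?addn1.
have v_gt0 s : 0 < v s.
  by elim: s => //= b s; rewrite -double_gt0 => /leq_trans->; rewrite ?leq_addr.
have v_inj : injective v.
  elim=> [|b s IHs] [|c t] //=.
  - by move: (v_gt0 t); case: (v t) => [//|k] _; rewrite doubleS.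
  - by move: (v_gt0 s); case: (v s) => [//|k] _; rewrite doubleS.
  move=> e; have ebc : b = c.
    by move/(congr1 odd): e; rewrite !oddD !odd_double /= !oddb.
  by move: e; rewrite ebc => /addIn /double_inj /IHs->.
move=> s; rewrite /str_of_nat -[RHS]revK; congr rev; apply: v_inj.
have vn n : v (iter n succ_rev [::]) = n.+1.
  by elim: n => //= n IHn; rewrite vS IHn.
by rewrite vn /nat_of_str -[s in LHS]revK foldl_rev prednK ?v_gt0.
Qed.

(* Tape symbols: [None] is the blank.                                          *)
Definition symbol := option bool.

Inductive action := Write of symbol | MoveLeft | MoveRight.

Definition action_code (a : action) : symbol + bool :=
  match a with
  | Write s => inl s
  | MoveLeft => inr false
  | MoveRight => inr true
  end.

Definition action_decode (c : symbol + bool) : action :=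
  match c with
  | inl s => Write s
  | inr false => MoveLeft
  | inr true => MoveRight
  end.

Lemma action_codeK : cancel action_code action_decode.
Proof. by case. Qed.

HB.instance Definition _ := Countable.copy action (can_type action_codeK).

(* Deterministic one-tape machines with n.+1 states, initial state [ord0] and  *)
(* partial transition table: the machine halts exactly when no transition is   *)
(* given for the current state and scanned symbol.                             *)
Definition TM : countType :=
  {n : nat & {ffun 'I_n.+1 * symbol -> option ('I_n.+1 * action)}}.

Record config (n : nat) := Config {
  cstate : 'I_n.+1;
  chead : int;
  ctape : int -> symbol
}.

Definition step (M : TM) (c : config (tag M)) : option (config (tag M)) :=
  if tagged M (cstate c, ctape c (chead c)) is Some (q, a) then
    Some (match a with
          | Write s => Config q (chead c)
                         (fun j => if j == chead c then s else ctape c j)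
          | MoveLeft => Config q (chead c - 1)%R (ctape c)
          | MoveRight => Config q (chead c + 1)%R (ctape c)
          end)
  else None.

(* The input is written on cells 0, 1, ..., with the head on cell 0.           *)
Definition init (M : TM) (x : string) : config (tag M) :=
  Config ord0 0%R (fun j => if j is Posz k then onth x k else None).

(* The output is the string of bits read from the head rightwards up to the    *)
(* first blank.                                                                *)
Definition output n (c : config n) (y : string) : Prop :=
  forall k : nat, k <= size y -> ctape c (chead c + k%:Z)%R = onth y k.

(* [computes M x y] means M(x) = y; M(x) is undefined when no such y exists.   *)
Definition computes (M : TM) (x y : string) : Prop :=
  exists (t : nat) (c : config (tag M)),
    [/\ iter t (obind (@step M)) (Some (init M x)) = Some c,
        step c = None
      & output c y].

(* All machines are listed, and (the code of) T_i is computable from i.        *)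
Definition standard_enumeration (T : nat -> TM) : Prop :=
  (forall M : TM, exists i, T i = M) /\
  (exists E : TM, forall i,
     computes E (str_of_nat i) (str_of_nat (pickle (T i)))).

(* U(<<i, p>, y>) = T_i(<p, y>), as an equality of partial functions.          *)
Definition universal (T : nat -> TM) (U : TM) : Prop :=
  forall (i : nat) (p y x : string),
    computes U (pair_str (pair_str (str_of_nat i) p) y) x <->
    computes (T i) (pair_str p y) x.

Definition has_program (U : TM) (x y : string) (k : nat) : bool :=
  `[< exists p : string, size p = k /\ computes U (pair_str p y) x >].

(* C(x | y). The value 0 in the second branch is a dummy: for universal U      *)
(* every x has a program given y.                                              *)
Definition condC (U : TM) (x y : string) : nat :=
  if pselect (exists k, has_program U x y k) is left ex then ex_minn ex else 0.

Definition plainC (U : TM) (x : string) : nat := condC U x [::].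

(* Main.v *)
Require Import Defs.
From HB Require Import structures.
From mathcomp Require Import all_boot all_order all_algebra.
From mathcomp Require Import boolp.
From mathcomp Require Import zify.

Set Implicit Arguments.
Unset Strict Implicit.
Unset Printing Implicit Defensive.

(** Let [T i] be a machine that never halts.  All the programs [<i, q>] are
    then wasted for [U], whatever the condition is, and for large [n] they are
    a fixed proportion of the fewer than [2 ^ n] programs of length less than
    [n].  The remaining programs are too few to describe all strings of length
    [n], and the same proportion of these strings has no program of length
    less than [n]. *)

(** The case [k = size y] of [output] makes the cell after the string blank, so the shorter of two
    outputs forces the longer one to end there too. *)
Lemma output_inj (n : nat) (c : config n) (x y : string) :
  output c x -> output c y -> x = y.
Proof.
wlog le_xy : x y / size x <= size y => [hwlog|] cx cy.
  by have [/hwlog|/ltnW/hwlog h] := leqP (size x) (size y); [exact|rewrite h].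
have le_yx : size y <= size x by rewrite -onthNE -cy // cx // onth_default.
have e_xy : size x = size y by apply/eqP; rewrite eqn_leq le_xy.
apply: eq_from_onth_le => k; rewrite e_xy maxnn => /ltnW le_k.
by rewrite -cx ?e_xy // cy.
Qed.

Lemma computes_fun (M : TM) (z x y : string) :
  computes M z x -> computes M z y -> x = y.
Proof.
move=> [t [c [rc hc oc]]] [t' [c' [rc' hc' oc']]].
wlog le_t : t t' c c' x y rc hc oc rc' hc' oc' / t <= t' => [hwlog|].
  have [|/ltnW] := leqP t t'; first exact: (hwlog t t' c c').
  by move=> le_t; symmetry; apply: (hwlog t' t c' c).
have iterN k : iter k (obind (@step M)) None = None by elim: k => //= k ->.
move: rc'; rewrite -(subnK le_t) iterD rc.
case: (t' - t) => [[eq_c]|k]; last by rewrite iterSr /= hc iterN.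
by apply: (@output_inj _ c) => //; rewrite eq_c.
Qed.

Definition loop_tm : TM :=
  existT _ 0 [ffun _ => Some (ord0, MoveRight)].

Lemma loop_tmP (z x : string) : ~ computes loop_tm z x.
Proof. by move=> [t [c [_ + _]]]; rewrite /step /= ffunE. Qed.

Definition act (a : action) (ht : int * (int -> symbol)) :=
  match a with
  | Write s => (ht.1, fun j => if j == ht.1 then s else ht.2 j)
  | MoveLeft => ((ht.1 - 1)%R, ht.2)
  | MoveRight => ((ht.1 + 1)%R, ht.2)
  end.

(** The state is a program counter; the last state, [size s], has no transition and is the halting
    one. *)
Definition straight_tm (s : seq action) : TM :=
  existT _ (size s)
    [ffun qa : 'I_(size s).+1 * symbol =>
       omap (pair (inord qa.1.+1)) (onth s qa.1)].

Lemma straight_tmP (s : seq action) (x : string) (k : nat) : k <= size s ->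
  let ht := foldl (fun ht a => act a ht) (chead (init (straight_tm s) x),
              ctape (init (straight_tm s) x)) (take k s) in
  iter k (obind (@step (straight_tm s))) (Some (init (straight_tm s) x))
    = Some (Config (inord k : 'I_(size s).+1) ht.1 ht.2).
Proof.
elim: k => [|k IHk] le_k /=.
  rewrite take0 /=; congr (Some (Config _ _ _)).
  by apply/val_inj; rewrite /= inordK.
rewrite IHk 1?ltnW // /= /step /= ffunE /= inordK ?ltnS 1?ltnW //.
rewrite onthE (nth_map MoveLeft) //= (take_nth MoveLeft) // foldl_rcons.
by case: (nth _ _ _).
Qed.

(** The terminating blank is written first and the bits then go leftwards from the last to the
    first, so the head ends on the first bit and the input is cut off by the blank. *)
Fixpoint print_actions (x : string) : seq action :=
  if x is b :: x' then print_actions x' ++ [:: MoveLeft; Write (Some b)]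
  else [:: Write None].

Lemma print_actionsP (x : string) ht (k : nat) : k <= size x ->
  let ht' := foldl (fun ht a => act a ht) ht (print_actions x) in
  ht'.2 (ht'.1 + k%:Z)%R = onth x k.
Proof.
elim: x k => [|b x IHx] k /=.
  by case: k => // _; rewrite GRing.addr0 eqxx.
rewrite foldl_cat /=; case: k => [|k] le_k; first by rewrite GRing.addr0 eqxx.
rewrite ifF; last by lia.
by rewrite -[RHS](IHx k) //; congr (_ _); lia.
Qed.

Lemma computes_const (x : string) : exists M : TM, forall z, computes M z x.
Proof.
pose M := straight_tm (print_actions x); exists M => z.
exists (size (print_actions x)); eexists; split.
- exact: straight_tmP.
- by rewrite /step /= ffunE /= inordK // onth_default.
- by rewrite take_size => k le_k; apply: print_actionsP.
Qed.

(* The constant machines exclude the dummy value 0 of [condC]. *)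
Lemma short_program (T : nat -> TM) (U : TM) (x y : string) (n : nat) :
    standard_enumeration T -> universal T U -> condC U x y < n ->
  exists p : string, size p < n /\ computes U (pair_str p y) x.
Proof.
move=> [T_surj _] hU; rewrite /condC; case: pselect => [ex|noprog].
  by case: ex_minnP => k /asboolP[p [<- px]] _ lt_n; exists p.
have [M Mx] := computes_const x; have [i Ti] := T_surj M.
case: noprog; exists (size (pair_str (str_of_nat i) [::])).
by apply/asboolP; eexists; split=> //; apply/hU; rewrite Ti.
Qed.

Lemma size_pair_str (x y : string) :
  size (pair_str x y) = (size x).*2 + (size y).+1.
Proof. by rewrite size_cat size_nseq /= size_cat -addnn; lia. Qed.

(** The first [true] marks where [p] begins, so the programs of length less than [n] embed into
    [n.-tuple bool] and can be counted there. *)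
Definition pad (n : nat) (p : string) : string :=
  nseq (n - (size p).+1) false ++ true :: p.

Lemma size_pad (n : nat) (p : string) : size p < n -> size (pad n p) = n.
Proof. by move=> lt_n; rewrite size_cat size_nseq subnK. Qed.

Lemma pad_inj (n : nat) : injective (pad n).
Proof.
suff padK p : behead (drop (find id (pad n p)) (pad n p)) = p.
  by move=> p q e; rewrite -[p]padK e padK.
by rewrite /pad; elim: (n - _) => //=; rewrite ?drop0.
Qed.

(** The constant depends only on an index of the looping machine and not on [y], so it serves both
    the condition [str_of_nat n] and the empty one. *)
Lemma card_incompressible (T : nat -> TM) (U : TM) :
    standard_enumeration T -> universal T U ->
  exists d : nat, 0 < d /\ forall (n : nat) (y : string),
    2 ^ n %/ d <= #|[set x : n.-tuple bool | n <= condC U x y]|.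
Proof.
move=> hT hU; have [i Ti] := hT.1 loop_tm.
(* With this [l], pairing [i] with a string of length [n - l] gives a program of length exactly
   [n - 1]. When [n < l] the bound is 0. *)
pose l := (size (str_of_nat i)).*2.+2.
exists (2 ^ l); split=> [|n y]; first by rewrite expn_gt0.
have [lt_nl|le_ln] := ltnP n l; first by rewrite divn_small // ltn_exp2l.
rewrite -expnB //; set A := [set x : n.-tuple bool | _].
(* The membership is put under the existential so that [choice] yields a total function. *)
have {}hprog (x : n.-tuple bool) : exists p : string,
    x \in ~: A -> size p < n /\ computes U (pair_str p y) x.
  have [|xA] := boolP (x \in ~: A); last by exists [::].
  rewrite !inE -ltnNge => /(short_program hT hU)[p hp].
  by exists p.
have [f fP] := choice hprog.
pose w (q : (n - l).-tuple bool) := pair_str (str_of_nat i) q.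
have size_w q : size (w q) < n by rewrite size_pair_str size_tuple /l; lia.
(* [F] sends compressible strings to their padded programs, [G] lists the wasted ones. The default
   tuple never occurs for [G], nor for [F] on [~: A]. *)
pose F x : n.-tuple bool := insubd [tuple of nseq n false] (pad n (f x)).
pose G q : n.-tuple bool := insubd [tuple of nseq n false] (pad n (w q)).
have valF x : x \in ~: A -> val (F x) = pad n (f x).
  by move=> /fP[lt_n _]; rewrite val_insubd size_pad ?eqxx.
have valG q : val (G q) = pad n (w q).
  by rewrite val_insubd size_pad ?eqxx.
have F_inj : {in ~: A &, injective F}.
  move=> x x' xA x'A /(congr1 val); rewrite !valF // => /pad_inj e.
  apply: val_inj; have [_ cx] := fP _ xA; have [_ cx'] := fP _ x'A.
  by apply: (computes_fun cx); rewrite e.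
have G_inj : injective G.
  move=> q q' /(congr1 val); rewrite !valG => /pad_inj /pair_str_inj[_].
  exact: val_inj.
have FG_disj : [disjoint F @: (~: A) & G @: setT].
  apply/pred0P => z /=; apply/negP => /andP[/imsetP[x xA ->] /imsetP[q _]].
  move/(congr1 val); rewrite valF // valG => /pad_inj e.
  have [_] := fP _ xA; rewrite e => /hU; rewrite Ti; exact: loop_tmP.
(* Disjointness gives [#|~: A| + 2 ^ (n - l) <= 2 ^ n = #|A| + #|~: A|], and [#|~: A|] cancels. *)
have: #|(F @: (~: A)) :|: (G @: setT)| <= #|{: n.-tuple bool}|.
  exact: max_card.
rewrite cardsU (disjoint_setI0 FG_disj) cards0 subn0 card_in_imset //.
rewrite card_imset // cardsT -(cardsC A) !card_tuple card_bool addnC.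
by rewrite leq_add2r.
Qed.

Theorem theorem1 (T : nat -> TM) (U : TM)
    (hT : standard_enumeration T) (hU : universal T U) :
  (exists d : nat, 0 < d /\
     forall n : nat,
       2 ^ n %/ d <= #|[set x : n.-tuple bool | n <= condC U x (str_of_nat n)]|)
  /\
  (exists d : nat, 0 < d /\
     forall n : nat,
       2 ^ n %/ d <= #|[set x : n.-tuple bool | n <= plainC U x]|).
Proof.
have [d [d_gt0 hd]] := card_incompressible hT hU.
by split; exists d; split=> // n; apply: hd.
Qed.
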